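(* Fix $r\ge 1$ and $n_0\ge 2$, let $\mathcal{C}$ be an order-invariant set of partial colored permutations on $\mathfrak{S}_{n_0,r}$, all of size $m$, and let $(X_n)_{n\ge1}$ be the $r$-colored order-invariant extension of $\mathcal{C}$. Then for every $k\ge 1$ there exists a polynomial $p(n)$ of degree at most $mk$ such that for every $n\ge 1$ and every conjugacy class $C_{\boldsymbol{\lambda}_n}$ of $\mathfrak{S}_{n,r}$ with no cycles of length $1,2,\ldots,mk$, we have $p(n)=\mathbb{E}_{\boldsymbol{\lambda}_n}[X_n^k]$.
   Context: The colored permutation group $\mathfrak{S}_{n,r}=\mathbb{Z}_r\wr\mathfrak{S}_n$ consists of pairs $(\omega,\tau)$ with $\omega\in\mathfrak{S}_n$, $\tau:[n]\to\mathbb{Z}_r$, acting on $\{i^c:i\in[n],c\in\mathbb{Z}_r\}$ by $(\omega,\tau)(i^c)=\omega(i)^{\tau(\omega(i))+c}$. A cycle of $(\omega,\tau)$ is a cycle of $\omega$, with length its length and color the sum in $\mathbb{Z}_r$ of $\tau(j)$ over its elements $j$. Conjugacy classes $C_{\boldsymbol{\lambda}}$ are the sets of elements with a given multiset of (length, color) pairs of cycles; $\mathbb{E}_{\boldsymbol{\lambda}}$ is expectation under the uniform distribution on $C_{\boldsymbol{\lambda}}$. A partial colored permutation of size $m$ on $\mathfrak{S}_{n,r}$ is $(K,\kappa)$ with $K=\{(i_h,j_h)\}_{h=1}^m\subseteq[n]\times[n]$, the $i_h$ distinct, the $j_h$ distinct, and $\kappa:\{j_1,\dots,j_m\}\to\mathbb{Z}_r$;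 $(\omega,\tau)$ satisfies it if $\omega(i_h)=j_h$ and $\tau(j_h)=\kappa(j_h)$ for all $h$, and $I_{(K,\kappa)}$ is the indicator of this. Its support is the set $\operatorname{supp}(K,\kappa)=\{i_1,\dots,i_m,j_1,\dots,j_m\}$. For an order-preserving injection $f$ from a set containing the support into $[N]$, $f(K,\kappa)$ is the partial colored permutation $(\{(f(i_h),f(j_h))\}_h,\{(f(j_h),\kappa(j_h))\}_h)$. A set $\mathcal{C}$ of partial colored permutations on $\mathfrak{S}_{n_0,r}$ is order-invariant if all its members have the same size and for every $(K,\kappa)\in\mathcal{C}$ and every order-preserving $f:\operatorname{supp}(K,\kappa)\to[n_0]$ we have $f(K,\kappa)\in\mathcal{C}$. The $r$-colored order-invariant extension of $\mathcal{C}$ is the sequence of statistics $X_n=\sum_{(K,\kappa)\in\mathcal{C}_n}I_{(K,\kappa)}$ on $\mathfrak{S}_{n,r}$, where for $n\le n_0$, $\mathcal{C}_n$ is the set of $(K,\kappa)\in\mathcal{C}$ with support contained in $[n]$, and for $n\ge n_0$, $\mathcal{C}_n$ is the set of all $f(K,\kappa)$ with $(K,\kappa)\in\mathcal{C}$ and $f:[n_0]\to[n]$ order-preserving. *)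

(* Defs.v *)
From HB Require Import structures.
From mathcomp Require Import all_boot all_order all_fingroup all_algebra.

Set Implicit Arguments.
Unset Strict Implicit.
Unset Printing Implicit Defensive.

Import GRing.Theory.
Local Open Scope ring_scope.

(* The additive group Z_r for r >= 1. 'Z_r is not suitable here: 'Z_1 is Z/2. *)
Definition color (r : nat) := 'I_r.-1.+1.

Definition cperm (n r : nat) : Type := ('S_n * {ffun 'I_n -> color r})%type.

(* The multiset of (length, color) pairs of the cycles, fixed points included,
   as a sequence to be read up to perm_eq. *)
Definition cycle_type (n r : nat) (x : cperm n r) : seq (nat * color r) :=
  [seq (#|B|, \sum_(j in B) x.2 j) | B : {set 'I_n} <- enum (porbits x.1)].

(* C_lambda; it is empty when lambda is not the cycle type of any element. *)
Definition conj_class (n r : nat) (lam : seq (nat * color r)) :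
    {set cperm n r} :=
  [set x : cperm n r | perm_eq (cycle_type x) lam].

Definition expect (n r : nat) (lam : seq (nat * color r))
    (Y : cperm n r -> rat) : rat :=
  (\sum_(x in conj_class n lam) Y x) / #|conj_class n lam|%:R.

(* A pair (K, kappa), where the function kappa is given by its graph; the
   required conditions on the pair are is_pcperm. *)
Definition pcperm (n r : nat) : Type :=
  ({set 'I_n * 'I_n} * {set 'I_n * color r})%type.

Definition is_pcperm (n r : nat) (P : pcperm n r) : Prop :=
  [/\ {in P.1 &, injective (fun ij : 'I_n * 'I_n => ij.1)},
      {in P.1 &, injective (fun ij : 'I_n * 'I_n => ij.2)},
      {in P.2 &, injective (fun jc : 'I_n * color r => jc.1)}
    & [set jc.1 | jc in P.2] = [set ij.2 | ij in P.1]].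

Definition pcsize (n r : nat) (P : pcperm n r) : nat := #|P.1|.

Definition supp (n r : nat) (P : pcperm n r) : {set 'I_n} :=
  [set ij.1 | ij in P.1] :|: [set ij.2 | ij in P.1].

Definition satisfies (n r : nat) (x : cperm n r) (P : pcperm n r) : bool :=
  [forall ij in P.1, x.1 ij.1 == ij.2] && [forall jc in P.2, x.2 jc.1 == jc.2].

(* f (K, kappa); only the values of f on supp P matter. *)
Definition pcmap (n N r : nat) (f : 'I_n -> 'I_N) (P : pcperm n r) :
    pcperm N r :=
  ([set (f ij.1, f ij.2) | ij in P.1], [set (f jc.1, jc.2) | jc in P.2]).

(* An order-preserving injection supp P -> [n0] is represented by a total
   function that is strictly increasing on supp P. *)
Definition order_invariant (n0 r m : nat) (C : {set pcperm n0 r}) : Prop :=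
  [/\ forall P, P \in C -> is_pcperm P,
      forall P, P \in C -> pcsize P = m
    & forall P, P \in C -> forall f : 'I_n0 -> 'I_n0,
        {in supp P &, {homo f : i j / (i < j)%N}} -> pcmap f P \in C].

(* C_n. For n <= n0 the members of C with support in [n] are the images, under
   the inclusion of [n] in [n0], of partial colored permutations on [n]. *)
Definition extension (n0 r : nat) (C : {set pcperm n0 r}) (n : nat) :
    {set pcperm n r} :=
  match leqP n n0 with
  | LeqNotGtn le_n_n0 =>
      [set P : pcperm n r | pcmap (widen_ord le_n_n0) P \in C]
  | GtnNotLeq _ =>
      [set pcmap (fP.1 : {ffun 'I_n0 -> 'I_n}) fP.2 |
         fP : {ffun 'I_n0 -> 'I_n} * pcperm n0 r &
         [forall i : 'I_n0, forall j : 'I_n0, (i < j)%N ==> (fP.1 i < fP.1 j)%N]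
         && (fP.2 \in C)]
  end.

Definition ext_stat (n0 r : nat) (C : {set pcperm n0 r}) (n : nat)
    (x : cperm n r) : rat :=
  \sum_(P in extension C n) (satisfies x P)%:R.

(* Main.v *)
Require Import Defs.
From HB Require Import structures.
From mathcomp Require Import all_boot all_order all_fingroup all_algebra.

Import Order.TTheory GRing.Theory Num.Theory.
Local Open Scope ring_scope.

Set Implicit Arguments.
Unset Strict Implicit.
Unset Printing Implicit Defensive.

(* Idea.  A conjugacy class is invariant under conjugation, so the expectation
   may be averaged over all conjugates of a fixed x.  Expand X_n^k over k-tuples
   of partial colored permutations and group the tuples by their joint support
   U.  By order invariance the tuples with support U are the images of a set of
   patterns on [s], s = #|U| <= 2mk, that does not depend on n.  Averaging turns
   the sum over the binom(n, s) sets U of a pattern Q into N_Q(x) / (s! r^s),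
   where N_Q(x) counts the families of s colored points over distinct elements
   of [n] on which x acts as Q prescribes.  It remains to see that N_Q(x) is a
   polynomial in n of degree at most mk when x has no cycle of length <= mk.
   Inclusion-exclusion on the distinctness conditions leaves systems of
   equations x^a f_i = x^b f_j (up to a color).  Such a system is solved by
   eliminating one variable at a time; the exponents stay so small that an
   equation between two powers at the same point is either trivial or excluded
   by the absence of short cycles, and each remaining free variable contributes
   a factor n r. *)

(** * Equations between colored points *)

Definition cpoint (n r : nat) := ('I_n * color r)%type.

Definition cact (n r : nat) (x : cperm n r) (y : cpoint n r) : cpoint n r :=
  (x.1 y.1, y.2 + x.2 (x.1 y.1)).

Definition cshift (n r : nat) (c : color r) (y : cpoint n r) : cpoint n r :=
  (y.1, y.2 + c).

(** Phrased through iterates, since the elimination meets short cycles only as coincidences between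
    two powers of [x] at one point. *)
Definition long_cycles (n r q : nat) (x : cperm n r) : Prop :=
  forall (i : 'I_n) (p : nat), (0 < p <= q)%N -> iter p x.1 i != i.

Section ColoredPoints.
Variables (n r : nat) (x : cperm n r).
Implicit Types (y z : cpoint n r) (c : color r).

Lemma cact_inj : injective (cact x).
Proof.
move=> [i c] [j d]; rewrite /cact /=.
move=> ij; have /= /perm_inj eq_ij := congr1 fst ij.
by have /= := congr1 snd ij; rewrite -eq_ij => /addIr ->.
Qed.

Lemma cshiftA c d y : cshift c (cshift d y) = cshift (c + d) y.
Proof. by rewrite /cshift /= -addrA [d + c]addrC. Qed.

Lemma cshift0 y : cshift 0 y = y.
Proof. by case: y => i c; rewrite /cshift addr0. Qed.

Lemma cact_shift c y : cact x (cshift c y) = cshift c (cact x y).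
Proof. by rewrite /cact /cshift /= addrAC. Qed.

Lemma iter_cact_shift p c y :
  iter p (cact x) (cshift c y) = cshift c (iter p (cact x) y).
Proof. by elim: p => //= p ->; rewrite cact_shift. Qed.

Lemma iter_cact_inj p : injective (iter p (cact x)).
Proof. by elim: p => [|p IH] y z //= /cact_inj /IH. Qed.

Lemma iter_cact1 p y : (iter p (cact x) y).1 = iter p x.1 y.1.
Proof. by elim: p => //= p ->. Qed.

Lemma eq_cshift c y z : (cshift c y == z) = (y == cshift (- c) z).
Proof.
by apply/eqP/eqP=> [<-|->]; rewrite cshiftA ?addrN ?addNr cshift0.
Qed.

(** Lying over the same element of [[n]] splits into mutually exclusive equations, one per color
    shift. This turns a failed distinctness condition into constraints. *)
Lemma sum_eq_cshift y z : (\sum_c (cshift c y == z) = (y.1 == z.1))%N.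
Proof.
rewrite (bigD1 (z.2 - y.2)) //= big1 => [|c /eqP cD].
  case: y z => [i c] [j d]; rewrite addn0 /cshift /= addrC subrK -!pair_eqE /=.
  by rewrite eqxx andbT.
apply/eqP; rewrite eqb0; apply: contra_notN cD => /eqP <- /=.
by rewrite addrC addKr.
Qed.

End ColoredPoints.

(* The constraint [((i, a), (j, b), c)] on a family [f] of colored points says
   that [x^a (f i)], with its color shifted by [c], is [x^b (f j)]. *)
Definition constraint (d r : nat) :=
  (('I_d * nat) * ('I_d * nat) * color r)%type.

Definition holds (n r d : nat) (x : cperm n r)
    (f : {ffun 'I_d -> cpoint n r}) (e : constraint d r) : bool :=
  cshift e.2 (iter e.1.1.2 (cact x) (f e.1.1.1))
  == iter e.1.2.2 (cact x) (f e.1.2.1).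

Definition solutions (n r d : nat) (x : cperm n r) (L : seq (constraint d r)) :=
  [set f : {ffun 'I_d -> cpoint n r} | all (holds x f) L].

Definition weighted (d r : nat) (w : 'I_d -> nat) (L : seq (constraint d r)) :=
  forall e, e \in L -> (e.1.1.2 <= w e.1.1.1)%N /\ (e.1.2.2 <= w e.1.2.1)%N.

(* Isolated variables of weight 0 are excluded, so that the number of connected
   components, hence the degree of the count, is at most the total weight. *)
Definition covered (d r : nat) (w : 'I_d -> nat) (L : seq (constraint d r)) :=
  forall i, (0 < w i)%N \/ exists e, e \in L /\
    (e.1.1.1 = i /\ (0 < w e.1.2.1)%N \/ e.1.2.1 = i /\ (0 < w e.1.1.1)%N).

Definition flip_constraint (d r : nat) (e : constraint d r) : constraint d r :=
  (e.1.2, e.1.1, - e.2).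

Lemma holds_flip n r d (x : cperm n r) (f : {ffun 'I_d -> cpoint n r}) e :
  holds x f (flip_constraint e) = holds x f e.
Proof. by rewrite /holds /= eq_cshift opprK eq_sym. Qed.

(* Elimination of [j] by means of an equation with [lift j i].  The merged
   variable receives the sum of the two weights: the total weight is preserved,
   and exponents remain bounded by the weights. *)
Section Merge.
Variables (d r : nat) (w : 'I_d.+1 -> nat) (j : 'I_d.+1) (i : 'I_d) (a b : nat).
Variables (c : color r) (L : seq (constraint d.+1 r)).
Hypothesis le_ba : (b <= a)%N.

Let e0 : constraint d.+1 r := ((lift j i, a), (j, b), c).

(** The action is injective and [b <= a], so [e0] says that [f j] is [x^(a - b)] of the value at
    [lift j i], shifted by [c]. The three maps below record this substitution; the default [i] of
    [odflt] is what renames [j]. *)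
Definition merge_var (v : 'I_d.+1) : 'I_d := odflt i (unlift j v).

Definition merge_exp (v : 'I_d.+1) : nat := if v == j then (a - b)%N else 0.

Definition merge_color (v : 'I_d.+1) : color r := if v == j then c else 0.

Definition merge_weight (k : 'I_d) : nat :=
  (\sum_(v | merge_var v == k) w v)%N.

Definition merge_constraint (e : constraint d.+1 r) : constraint d r :=
  ((merge_var e.1.1.1, e.1.1.2 + merge_exp e.1.1.1)%N,
   (merge_var e.1.2.1, e.1.2.2 + merge_exp e.1.2.1)%N,
   e.2 + merge_color e.1.1.1 - merge_color e.1.2.1).

Definition merge_ext n (x : cperm n r) (f : {ffun 'I_d -> cpoint n r}) :
    {ffun 'I_d.+1 -> cpoint n r} :=
  [ffun v => cshift (merge_color v)
               (iter (merge_exp v) (cact x) (f (merge_var v)))].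

Lemma merge_var_lift k : merge_var (lift j k) = k.
Proof. by rewrite /merge_var liftK. Qed.

Lemma merge_var_self : merge_var j = i.
Proof. by rewrite /merge_var unlift_none. Qed.

Lemma merge_ext_lift n (x : cperm n r) f k : merge_ext x f (lift j k) = f k.
Proof.
rewrite ffunE /merge_exp /merge_color merge_var_lift.
by rewrite eq_sym (negbTE (neq_lift _ _)) cshift0.
Qed.

Lemma merge_ext_self n (x : cperm n r) f :
  merge_ext x f j = cshift c (iter (a - b)%N (cact x) (f i)).
Proof. by rewrite ffunE /merge_exp /merge_color merge_var_self eqxx. Qed.

Lemma merge_ext_inj n (x : cperm n r) : injective (merge_ext x).
Proof.
move=> f g fg; apply/ffunP=> k.
by rewrite -(merge_ext_lift x f) fg merge_ext_lift.
Qed.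

Lemma holds_merge n (x : cperm n r) f e :
  holds x (merge_ext x f) e = holds x f (merge_constraint e).
Proof.
rewrite /holds /= !ffunE !iter_cact_shift -!iterD !cshiftA.
rewrite [LHS]eq_sym eq_cshift cshiftA eq_sym; congr (cshift _ _ == _).
by rewrite addrC.
Qed.

Lemma holds_head n (x : cperm n r) (g : {ffun 'I_d.+1 -> cpoint n r}) :
  holds x g e0 =
  (cshift c (iter (a - b)%N (cact x) (g (lift j i))) == g j).
Proof.
rewrite /holds /= -{1}(subnKC le_ba) iterD -iter_cact_shift.
exact/inj_eq/iter_cact_inj.
Qed.

(** [merge_ext] is a bijection between the two solution sets; its inverse forgets the coordinate
    [j], which [e0] determines. *)
Lemma card_solutions_merge n (x : cperm n r) :
  #|solutions x (e0 :: L)| = #|solutions x (map merge_constraint L)|.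
Proof.
rewrite -(card_imset _ (@merge_ext_inj n x)); apply/eq_card=> g.
rewrite inE; apply/idP/imsetP=> [/=/andP[]|[f + ->{g}]].
  rewrite holds_head => /eqP gj gL; pose f := [ffun k => g (lift j k)].
  have gE : g = merge_ext x f.
    apply/ffunP=> v; case: (unliftP j v) => [k|] ->.
      by rewrite merge_ext_lift ffunE.
    by rewrite merge_ext_self ffunE gj.
  exists f => //; rewrite inE all_map; apply: sub_all gL => e /=.
  by rewrite -holds_merge -gE.
rewrite inE all_map /= holds_head merge_ext_lift merge_ext_self eqxx /=.
by apply: sub_all => e /=; rewrite holds_merge.
Qed.

Lemma leq_merge_weight v : (w v <= merge_weight (merge_var v))%N.
Proof. by rewrite /merge_weight (bigD1 v) //= leq_addr. Qed.

Lemma merge_weighted :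
  weighted w (e0 :: L) -> weighted merge_weight (map merge_constraint L).
Proof.
move=> wL _ /mapP[e eL ->] /=.
have [/= wi wj] := wL _ (mem_head _ _).
(* At [j] the exponent grows by [a - b], which is at most the weight of [lift j i]; the merged
   weight contains both weights. *)
have le_w v p : (p <= w v -> p + merge_exp v <= merge_weight (merge_var v))%N.
  rewrite /merge_exp; case: eqP => [->|_] lep; last first.
    by rewrite addn0 (leq_trans lep) ?leq_merge_weight.
  rewrite /merge_weight (bigD1 j) //= (bigD1 (lift j i)) /=; last first.
    by rewrite merge_var_lift merge_var_self eqxx eq_sym neq_lift.
  rewrite leq_add // (leq_trans _ (leq_addr _ _)) //.
  by rewrite (leq_trans (leq_subr _ _)).
by have [] := wL e (mem_behead (s := e0 :: L) eL); split; apply: le_w.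
Qed.

Lemma merge_covered :
  covered w (e0 :: L) -> covered merge_weight (map merge_constraint L).
Proof.
move=> cL k.
have pos v : (0 < w v -> 0 < merge_weight (merge_var v))%N.
  by move=> ?; apply: leq_trans (leq_merge_weight v).
case: (cL (lift j k)) => [/pos|[e []]]; first by rewrite merge_var_lift; left.
rewrite inE => /predU1P[->|eL] /=.
  by case=> -[/(congr1 merge_var) + /pos];
    rewrite !(merge_var_lift, merge_var_self) => <-; left.
case=> -[ek /pos we]; right; exists (merge_constraint e); split;
  rewrite ?map_f //=; [left|right]; by rewrite ek merge_var_lift.
Qed.

Lemma sum_merge_weight : (\sum_k merge_weight k = \sum_v w v)%N.
Proof. by rewrite [RHS](partition_big merge_var predT). Qed.

End Merge.

(** * Polynomial counts of solutions *)

Lemma long_cycles_iter_inj n r q (x : cperm n r) i a b :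
  long_cycles q x -> (a <= q)%N -> (b <= q)%N ->
  iter a x.1 i = iter b x.1 i -> a = b.
Proof.
move=> lx; wlog le_ba : a b / (b <= a)%N.
  by move=> th; case/orP: (leq_total b a) => /th le_ab aq bq; first exact: le_ab;
    move/esym/(le_ab bq aq).
move=> aq bq eq_ab; apply/eqP; rewrite eqn_leq le_ba andbT leqNgt.
apply/negP=> lt_ba; apply: (negP (lx i (a - b)%N _)).
  by rewrite subn_gt0 lt_ba (leq_trans (leq_subr _ _)).
have it_inj: injective (iter b x.1) by elim: (b) => [|p IH] y z //= /perm_inj /IH.
by apply/eqP/it_inj; rewrite -iterD subnKC.
Qed.

(** Induction on the number of constraints. A constraint between two variables is merged away; one
    on a single variable is either vacuous or contradicts the absence of short cycles or the
    freeness of the color shift. *)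
Lemma card_solutions_poly (r q d : nat) (w : 'I_d -> nat)
    (L : seq (constraint d r)) :
  weighted w L -> covered w L -> (\sum_i w i <= q)%N ->
  exists p : {poly rat}, (size p <= q.+1)%N /\
    forall n (x : cperm n r), long_cycles q x ->
      p.[n%:R] = #|solutions x L|%:R.
Proof.
have [t] := ubnP (size L); elim: t d w L => // t IH d w [|e L] /=.
  (* Without constraints, coverage makes every weight positive, so [d <= q], and each variable
     ranges freely over [n * r] colored points. *)
  move=> _ _ cL sw; exists ((r.-1.+1%:R *: 'X) ^+ d); split=> [|n x _].
    have dq : (d <= q)%N.
      apply: leq_trans sw; rewrite -[X in (X <= _)%N]card_ord -sum1_card.
      by apply: leq_sum => i _; case: (cL i) => // -[e []].
    rewrite (leq_trans (size_poly_exp_leq _ _)) // ltnS.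
    rewrite (leq_trans _ dq) // -[X in (_ <= X)%N]mul1n leq_mul2r.
    by rewrite -subn1 leq_subLR (leq_trans (size_scale_leq _ _)) ?size_polyX ?orbT.
  rewrite !hornerE -natrM -natrX; congr (_%:R).
  have -> : solutions x (Nil (constraint d r)) = setT.
    by apply/setP=> f; rewrite !inE.
  by rewrite cardsT card_ffun card_prod !card_ord mulnC.
rewrite ltnS => szL wL cL sw.
have swap : covered w (flip_constraint e :: L) /\
            weighted w (flip_constraint e :: L).
  split=> [i|e']; last first.
    rewrite inE => /predU1P[->|eL] /=; last by apply: wL; rewrite inE eL orbT.
    by case: (wL e (mem_head _ _)).
  case: (cL i) => [|[e' []]]; first by left.
  rewrite inE => /predU1P[->|eL] H; right.
    by exists (flip_constraint e); rewrite mem_head; split=> //=; tauto.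
  by exists e'; rewrite inE eL orbT.
have solE n (x : cperm n r) :
    solutions x (e :: L) = solutions x (flip_constraint e :: L).
  by apply/setP=> f; rewrite !inE /= holds_flip.
(* Flipping the constraint puts the larger exponent on its first variable, as merging requires. *)
wlog le_ba : e wL cL swap solE / (e.1.2.2 <= e.1.1.2)%N.
  move=> th; case/orP: (leq_total e.1.2.2 e.1.1.2) => le_e.
    exact: (th e).
  have fK : flip_constraint (flip_constraint e) = e.
    case: e {wL cL swap solE th le_e} => [[u v] c].
    by rewrite /flip_constraint opprK.
  have [] := th (flip_constraint e) _ _ _ _ le_e; rewrite ?fK; try by case: swap.
  by move=> p [sp pE]; exists p; split=> // n x /pE; rewrite -solE.
case: e wL cL le_ba {swap solE} => [[[i a] [j b]] c] wL cL /= le_ba.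
have [eq_ij|neq_ij] := eqVneq i j; last first.
  case: d i j w L wL cL neq_ij sw szL => [|d] i j w L; first by case: i.
  case: (unliftP j i) => [k|] ->; last by rewrite eqxx.
  move=> wL cL _ sw szL.
  have [] := IH _ (merge_weight w j k) (map (merge_constraint j k a b c) L).
  - by rewrite size_map.
  - exact: merge_weighted wL.
  - exact: merge_covered cL.
  - by rewrite sum_merge_weight.
  by move=> p [sp pE]; exists p; split=> // n x /pE ->; rewrite card_solutions_merge.
rewrite -{j}eq_ij in wL cL *.
(* A contradictory constraint is met by the zero polynomial. *)
have solF : (forall n (x : cperm n r), long_cycles q x ->
       forall f, ~~ holds x f ((i, a), (i, b), c)) ->
    exists p : {poly rat}, (size p <= q.+1)%N /\
      forall n (x : cperm n r), long_cycles q x ->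
        p.[n%:R] = #|solutions x (((i, a), (i, b), c) :: L)|%:R.
  move=> noL; exists 0; split=> [|n x lx]; first by rewrite size_poly0.
  rewrite horner0 (_ : solutions _ _ = set0) ?cards0 //.
  by apply/setP=> f; rewrite !inE /= (negbTE (noL _ _ lx _)).
have [/= wa wb] := wL _ (mem_head _ _).
have wq : (w i <= q)%N by rewrite (leq_trans _ sw) // (bigD1 i) //= leq_addr.
have [eq_ab|neq_ab] := eqVneq a b; last first.
  apply: solF => n x lx f; apply: contra neq_ab => /eqP/(congr1 fst) /=.
  rewrite !iter_cact1 => /(long_cycles_iter_inj lx) -> //.
    exact: leq_trans wq.
  exact: leq_trans wq.
have [c0|c0] := eqVneq c 0; last first.
  apply: solF => n x lx f; apply: contra c0; rewrite /holds /= eq_ab.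
  move=> /eqP/(congr1 snd) /= /eqP; rewrite -subr_eq0 addrC addKr.
  by [].
have [] := IH d w L szL => //.
  by move=> e eL; apply: wL; rewrite inE eL orbT.
  (* Dropping a loop at [i] keeps coverage: a variable covered by the loop is [i] itself, and then
     its own weight is positive. *)
  move=> v; case: (cL v) => [|[e []]]; first by left.
  rewrite inE => /predU1P[-> /= H|eL H]; last by right; exists e.
  by left; case: H => -[<-].
move=> p [sp pE]; exists p; split=> // n x /pE ->; congr (_%:R).
apply/eq_card=> f; rewrite !inE /= /holds /= eq_ab c0 cshift0 eqxx.
by [].
Qed.

(** Conditions in [D] are removed one at a time. The families violating one are, over all colors
    [c], the disjoint solution sets of an extra constraint with both exponents 0, which respects any
    weights. *)
Lemma card_distinct_solutions_poly (r q d : nat) (w : 'I_d -> nat)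
    (L : seq (constraint d r)) (D : seq ('I_d * 'I_d)) :
  weighted w L -> covered w L -> (\sum_i w i <= q)%N ->
  exists p : {poly rat}, (size p <= q.+1)%N /\
    forall n (x : cperm n r), long_cycles q x ->
      p.[n%:R] = #|[set f in solutions x L |
                     all (fun ij => (f ij.1).1 != (f ij.2).1) D]|%:R.
Proof.
move=> + + sw; elim: D L => [|[i j] D IH] L wL cL.
  have [p [sp pE]] := card_solutions_poly wL cL sw; exists p; split=> // n x.
  by move/pE ->; congr (_%:R); apply/eq_card=> f; rewrite !inE andbT.
have [p [sp pE]] := IH L wL cL.
have [c|P_ PE] := @fin_all_exists (color r) (fun=> {poly rat}) (fun c P =>
    (size P <= q.+1)%N /\ forall n (x : cperm n r), long_cycles q x ->
    P.[n%:R] = #|[set f in solutions x (((i, 0), (j, 0), c) :: L) |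
                     all (fun ij => (f ij.1).1 != (f ij.2).1) D]|%:R).
  apply: IH => [e|k].
    by rewrite inE => /predU1P[->|/wL].
  by case: (cL k) => [|[e [eL H]]]; [left|right; exists e; rewrite inE eL orbT].
exists (p - \sum_c P_ c); split=> [|n x lx].
  rewrite (leq_trans (size_polyD _ _)) // geq_max sp size_polyN.
  rewrite (leq_trans (size_sum _ _ _)) //.
  by apply/bigmax_leqP=> c _; case: (PE c).
rewrite hornerD hornerN horner_sum (pE n x lx).
under eq_bigr => c _ do rewrite (proj2 (PE c) n x lx).
apply/eqP; rewrite subr_eq -natr_sum -natrD; apply/eqP; congr (_%:R).
rewrite -!sum1_card [LHS]big_mkcond [X in _ = (X + _)%N]big_mkcond /=.
under [X in _ = (_ + X)%N]eq_bigr => c _ do rewrite -sum1_card big_mkcond /=.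
rewrite exchange_big -big_split /=; apply: eq_bigr => f _; rewrite !inE /=.
under eq_bigr => c _ do rewrite !inE /=.
have E := sum_eq_cshift (f i) (f j).
case: (all _ D); rewrite ?andbF ?andbT; last by rewrite big1 // => c _; rewrite ?andbF.
case: (all _ L); rewrite ?andbF ?andbT; last by rewrite big1 // => c _; rewrite ?andbF.
rewrite /holds /=; under eq_bigr => c _ do rewrite !andbT.
transitivity (((f i).1 != (f j).1) + ((f i).1 == (f j).1))%N; first by case: eqP.
by congr (_ + _)%N; rewrite -E; apply: eq_bigr => c _; case: eqP.
Qed.

Lemma card_inj_solutions_poly (r q d : nat) (w : 'I_d -> nat)
    (L : seq (constraint d r)) :
  weighted w L -> covered w L -> (\sum_i w i <= q)%N ->
  exists p : {poly rat}, (size p <= q.+1)%N /\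
    forall n (x : cperm n r), long_cycles q x ->
      p.[n%:R] = #|[set f in solutions x L | injectiveb (fun i => (f i).1)]|%:R.
Proof.
move=> wL cL sw.
pose D := [seq ij : 'I_d * 'I_d <- enum setT | ij.1 != ij.2].
have [p [sp pE]] := card_distinct_solutions_poly D wL cL sw.
exists p; split=> // n x /pE ->; congr (_%:R).
apply/eq_card=> f; rewrite !inE; congr (_ && _).
apply/allP/injectiveP=> [fD i j|f_inj ij]; last first.
  rewrite mem_filter => /andP[+ _].
  by apply: contra => /eqP/f_inj/eqP.
move=> eqf; apply/eqP; apply: contraT => neq_ij.
by have := fD (i, j); rewrite mem_filter mem_enum inE neq_ij /= eqf eqxx => /(_ isT).
Qed.

(** * Order-invariant extensions *)

(** This condition of [is_pcperm] makes [pcmap f P] depend on [f] only through its values on the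
    support. *)
Definition wf_pcperm (n r : nat) (P : pcperm n r) : bool :=
  [set jc.1 | jc in P.2] == [set ij.2 | ij in P.1].

Definition incr_on (a b : nat) (A : {set 'I_a}) (f : 'I_a -> 'I_b) : Prop :=
  {in A &, {homo f : i j / (i < j)%N}}.

Lemma incr_on_ltn a b (A : {set 'I_a}) (f : 'I_a -> 'I_b) :
  incr_on A f -> {in A &, {mono f : i j / (i < j)%N}}.
Proof.
move=> fA i j iA jA; case: (ltngtP i j) => [/(fA i j iA jA)//|lt_ji|/val_inj->].
  by apply/negbTE; rewrite -leqNgt ltnW // fA.
by rewrite ltnn.
Qed.

Lemma incr_on_inj a b (A : {set 'I_a}) (f : 'I_a -> 'I_b) :
  incr_on A f -> {in A &, injective f}.
Proof.
move=> fA i j iA jA eq_f; apply/val_inj; case: (ltngtP i j) => // /(fA _ _) lt_f.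
  by have := lt_f iA jA; rewrite eq_f ltnn.
by have := lt_f jA iA; rewrite eq_f ltnn.
Qed.

Lemma incr_on_factor a b c (A : {set 'I_a}) (f : 'I_a -> 'I_b) (g : 'I_a -> 'I_c) :
  (0 < c)%N -> incr_on A f -> incr_on A g ->
  exists h : 'I_b -> 'I_c, {in A, h \o f =1 g} /\ incr_on (f @: A) h.
Proof.
move=> c_gt0 fA gA.
(* Off the image of [A], [h] takes the dummy value 0, available since [0 < c]. *)
pose h y := oapp g (Ordinal c_gt0) [pick i in A | f i == y].
have hf : {in A, h \o f =1 g}.
  move=> i iA; rewrite /h /=; case: pickP => [j /andP[jA /eqP]|/(_ i)].
    by move=> eq_f /=; congr g; apply: (incr_on_inj fA).
  by rewrite iA eqxx.
exists h; split=> // _ _ /imsetP[i iA ->] /imsetP[j jA ->].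
by rewrite (incr_on_ltn fA) // => lt_ij; rewrite !(hf _ _ : h (f _) = _) // gA.
Qed.

Section PartialColoredMaps.
Variable r : nat.

Lemma pcmap_comp a b c (f : 'I_a -> 'I_b) (g : 'I_b -> 'I_c) (P : pcperm a r) :
  pcmap g (pcmap f P) = pcmap (g \o f) P.
Proof. by rewrite /pcmap /= -!imset_comp. Qed.

Lemma supp_pcmap a b (f : 'I_a -> 'I_b) (P : pcperm a r) :
  supp (pcmap f P) = f @: supp P.
Proof. by rewrite /supp /= imsetU -!imset_comp. Qed.

Lemma supp1 n (P : pcperm n r) ij :
  ij \in P.1 -> (ij.1 \in supp P) && (ij.2 \in supp P).
Proof. by move=> ijP; rewrite !inE !imset_f ?orbT. Qed.

Lemma supp2 n (P : pcperm n r) jc : wf_pcperm P -> jc \in P.2 -> jc.1 \in supp P.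
Proof. by move=> /eqP wfP jcP; rewrite inE -wfP imset_f ?orbT. Qed.

Lemma eq_in_pcmap a b (f g : 'I_a -> 'I_b) (P : pcperm a r) :
  wf_pcperm P -> {in supp P, f =1 g} -> pcmap f P = pcmap g P.
Proof.
move=> wfP fg; congr (_, _); apply: eq_in_imset => u uP.
  by have /andP[? ?] := supp1 uP; rewrite !fg.
by rewrite fg // supp2.
Qed.

Lemma pcmap_id n (f : 'I_n -> 'I_n) (P : pcperm n r) :
  wf_pcperm P -> {in supp P, f =1 id} -> pcmap f P = P.
Proof.
move=> wfP fid; rewrite (eq_in_pcmap wfP fid); case: P {wfP fid} => K k.
rewrite /pcmap /=; congr (_, _).
  by rewrite -[RHS]imset_id; apply: eq_imset => -[].
by rewrite -[RHS]imset_id; apply: eq_imset => -[].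
Qed.

Lemma wf_pcmap_in a b (f : 'I_a -> 'I_b) (P : pcperm a r) :
  wf_pcperm P -> wf_pcperm (pcmap f P).
Proof.
rewrite /wf_pcperm /= -!imset_comp => /eqP eP.
by rewrite (imset_comp f fst) (imset_comp f snd) eP.
Qed.

Lemma wf_pcmap a b (f : 'I_a -> 'I_b) (P : pcperm a r) :
  injective f -> wf_pcperm (pcmap f P) = wf_pcperm P.
Proof.
move=> f_inj; rewrite /wf_pcperm /= -!imset_comp.
by rewrite (imset_comp f fst) (imset_comp f snd) (inj_eq (imset_inj f_inj)).
Qed.

Lemma pcmap_inj a b (f : 'I_a -> 'I_b) :
  injective f -> injective (pcmap f : pcperm a r -> pcperm b r).
Proof.
move=> f_inj [K k] [K' k'] eq_f; congr (_, _).
  by apply: imset_inj (congr1 fst eq_f) => -[? ?] [? ?] [/f_inj-> /f_inj->].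
by apply: imset_inj (congr1 snd eq_f) => -[? ?] [? ?] /= [/f_inj-> ->].
Qed.

Lemma pcmap_preim a b (f : 'I_a -> 'I_b) (P : pcperm b r) :
  wf_pcperm P -> supp P \subset codom f -> exists Q, P = pcmap f Q.
Proof.
move=> wfP /subsetP sP.
exists ([set ij | (f ij.1, f ij.2) \in P.1], [set jc | (f jc.1, jc.2) \in P.2]).
case: P wfP sP => K k wfP sP; congr (_, _); apply/setP=> u; apply/idP/imsetP => /=.
- move=> uK; have /andP[/sP/codomP[i ui] /sP/codomP[j uj]] := supp1 (P := (K, k)) uK.
  by exists (i, j); rewrite ?inE /= -ui -uj -surjective_pairing.
- by case=> ij; rewrite inE => ? ->.
- move=> uk; have /sP/codomP[j uj] := supp2 (P := (K, k)) wfP uk.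
  by exists (j, u.2); rewrite ?inE /= -uj -surjective_pairing.
by case=> jc; rewrite inE => ? ->.
Qed.

Lemma is_pcperm_wf n (P : pcperm n r) : is_pcperm P -> wf_pcperm P.
Proof. by case=> _ _ _ wfP; apply/eqP. Qed.

End PartialColoredMaps.

Lemma incr_enum_val n (A : {set 'I_n}) (i j : 'I_(#|A|)) :
  (i < j)%N -> (enum_val i < enum_val j)%N.
Proof.
move=> lt_ij; pose ltI := relpre (val : 'I_n -> nat) ltn.
have ltI_tr : transitive ltI by move=> ? ? ?; apply: ltn_trans.
have x0 : 'I_n := enum_val i.
rewrite !(enum_val_nth x0); apply: (sorted_ltn_nth ltI_tr); rewrite ?inE -?cardE //.
rewrite /enum_mem; apply: sorted_filter => //.
by rewrite -enumT -sorted_map val_enum_ord iota_ltn_sorted.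
Qed.

Lemma superset_of_card (T : finType) (A : {set T}) k :
  (#|A| <= k <= #|T|)%N -> exists2 B : {set T}, A \subset B & #|B| = k.
Proof.
case/andP=> le_Ak le_kT.
have /card_geqP[s [s_uniq s_size s_sub]] : (k - #|A| <= #|~: A|)%N.
  by rewrite leq_subLR cardsC.
exists (A :|: [set x in s]); first exact: subsetUl.
rewrite cardsU disjoint_setI0 ?cards0 ?subn0; last first.
  rewrite disjoint_sym disjoints_subset; apply/subsetP=> x; rewrite inE.
  exact: s_sub.
by rewrite cardsE (card_uniqP s_uniq) s_size subnKC.
Qed.

(** A uniform description of [C_n] for small and large [n], after which the case split in
    [extension] is no longer met. *)
Lemma mem_extension n0 r m (C : {set pcperm n0 r}) s (Q : pcperm s r) :
  (0 < n0)%N -> order_invariant m C ->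
  Q \in extension C s <->
  wf_pcperm Q /\ exists g : 'I_s -> 'I_n0, incr_on (supp Q) g /\ pcmap g Q \in C.
Proof.
move=> n0_gt0 [C_pc C_size C_inv]; rewrite /extension; case: leqP => [le_s|gt_s].
  have w_inj : injective (widen_ord le_s).
    by move=> i j E; apply/val_inj; exact: (congr1 (@nat_of_ord n0) E).
  rewrite inE; split=> [QC|[wfQ [g [g_incr QC]]]].
    split; last by exists (widen_ord le_s); split=> // i j.
    by rewrite -(wf_pcmap _ w_inj); apply: is_pcperm_wf (C_pc _ QC).
  (* Both [g] and the inclusion are increasing on the support, so they differ by an increasing map,
     under which [C] is stable. *)
  have w_incr : incr_on (supp Q) (widen_ord le_s) by move=> i j.
  have [h [hg h_incr]] := incr_on_factor n0_gt0 g_incr w_incr.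
  rewrite -(eq_in_pcmap wfQ hg) -pcmap_comp; apply: C_inv => //.
  by rewrite supp_pcmap.
split=> [/imsetP[[f R]]|[wfQ [g [g_incr QC]]]].
  rewrite inE /= => /andP[/forallP f_incr RC] ->.
  have wfR := is_pcperm_wf (C_pc _ RC).
  have fR : incr_on (supp R) f by move=> i j _ _; have /forallP/(_ j)/implyP := f_incr i.
  split; first exact: wf_pcmap_in.
  have [h [hf h_incr]] := incr_on_factor (g := id) n0_gt0 fR (fun _ _ _ _ => id).
  exists h; rewrite supp_pcmap; split=> //.
  by rewrite pcmap_comp (pcmap_id wfR hf).
(* [g] embeds the support in [[n0]], so it fits in a set [B] of exactly [n0] elements; the
   increasing enumeration of [B] is the required map from [[n0]]. *)
have [B sB cardB] : exists2 B : {set 'I_s}, supp Q \subset B & #|B| = n0.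
  apply: superset_of_card; rewrite card_ord (ltnW gt_s) andbT.
  by rewrite -(card_in_imset (incr_on_inj g_incr)) (leq_trans (max_card _)) ?card_ord.
pose f := [ffun i : 'I_n0 => enum_val (cast_ord (esym cardB) i)].
have f_incr : incr_on [set: 'I_n0] f.
  by move=> i j _ _ lt_ij; rewrite !ffunE incr_enum_val.
have sf : B = f @: [set: 'I_n0].
  apply/setP=> v; apply/idP/imsetP=> [vB|[i _ ->]]; last by rewrite ffunE enum_valP.
  exists (cast_ord cardB (enum_rank_in vB v)) => //.
  by rewrite ffunE cast_ordK enum_rankK_in.
have [R QR] : exists R, Q = pcmap f R.
  apply: pcmap_preim => //; apply/subsetP=> v /(subsetP sB).
  by rewrite sf => /imsetP[i _ ->]; apply: codom_f.
have f_inj : injective f by move=> i j; apply: (incr_on_inj f_incr); rewrite inE.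
have wfR : wf_pcperm R by rewrite -(wf_pcmap _ f_inj) -QR.
(* [k] is a left inverse of [f], increasing on [B]. Thus [R] is the image of [Q] under [k], and
   order invariance carries membership from [pcmap g Q] to [R]. *)
have [k [kf k_incr]] := incr_on_factor (g := id) n0_gt0 f_incr (fun _ _ _ _ => id).
have kQ : incr_on (supp Q) k.
  by move=> i j /(subsetP sB) iB /(subsetP sB) jB; apply: k_incr; rewrite -sf.
have [h [hg h_incr]] := incr_on_factor n0_gt0 g_incr kQ.
apply/imsetP; exists (f, R) => //; rewrite inE /=; apply/andP; split.
  apply/forallP=> i; apply/forallP=> j; apply/implyP; apply: f_incr; by rewrite inE.
have <- : pcmap h (pcmap g Q) = R.
  rewrite pcmap_comp (eq_in_pcmap wfQ hg) QR pcmap_comp pcmap_id // => i _.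
  by apply: kf; rewrite inE.
by apply: C_inv => //; rewrite supp_pcmap.
Qed.

(** This is why the patterns found on a support do not depend on its position in [[n]]. *)
Lemma pcmap_extension n0 r m (C : {set pcperm n0 r}) s n (f : 'I_s -> 'I_n) Q :
  (0 < n0)%N -> order_invariant m C -> {homo f : i j / (i < j)%N} ->
  (pcmap f Q \in extension C n) = (Q \in extension C s).
Proof.
move=> n0_gt0 C_inv f_incr.
have fQ : incr_on (supp Q) f by move=> i j _ _; apply: f_incr.
have f_inj : injective f.
  have fT : incr_on setT f by move=> i j _ _; apply: f_incr.
  by move=> i j; apply: (incr_on_inj fT); rewrite inE.
apply/idP/idP=> /(mem_extension _ n0_gt0 C_inv) [wfQ [g [g_incr gC]]];
    apply/(mem_extension _ n0_gt0 C_inv).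
  rewrite wf_pcmap // in wfQ; split=> //; exists (g \o f).
  rewrite -pcmap_comp; split=> // i j iQ jQ /= lt_ij.
  by apply: g_incr; rewrite ?supp_pcmap ?imset_f ?f_incr.
split; first by rewrite wf_pcmap.
have [h [hf h_incr]] := incr_on_factor n0_gt0 fQ g_incr.
exists h; rewrite supp_pcmap; split=> //.
by rewrite pcmap_comp (eq_in_pcmap wfQ hf).
Qed.

Lemma pcsize_extension n0 r m (C : {set pcperm n0 r}) s (Q : pcperm s r) :
  (0 < n0)%N -> order_invariant m C -> Q \in extension C s -> pcsize Q = m.
Proof.
move=> n0_gt0 C_inv /(mem_extension _ n0_gt0 C_inv) [wfQ [g [g_incr gC]]].
case: C_inv => _ /(_ _ gC) <- _; rewrite /pcsize card_in_imset // => u v uQ vQ.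
have /andP[u1 u2] := supp1 uQ; have /andP[v1 v2] := supp1 vQ.
case: u v u1 u2 v1 v2 {uQ vQ} => [a b] [c d] /= ? ? ? ? [] E F.
by congr (_, _); apply: (incr_on_inj g_incr).
Qed.

(** * Averaging over conjugates *)

Section Conjugation.
Variables (n r : nat).
Implicit Types (x : cperm n r) (s : 'S_n) (t : {ffun 'I_n -> color r}).

(** The conjugate of [x] by the map taking [i^c] to [s(i)^(t(i) + c)]: that map followed by [x]
    equals the conjugate followed by that map. Here [t] is indexed by the source [i], unlike the
    color function of an element. *)
Definition cconj s t x : cperm n r :=
  let w := (s * x.1 * s^-1)%g in
  (w, [ffun j => x.2 (s j) + t ((w^-1)%g j) - t j]).

Lemma cconj_inj s t : injective (cconj s t).
Proof.
move=> x y E; have E1 := congr1 fst E; have E2 := congr1 snd E.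
move: E1 E2; rewrite /= => E1.
have /mulgI xy := mulIg _ _ _ E1; rewrite xy => E2.
case: x y xy {E E1} E2 => [w t1] [w' t2] /= <- E2; congr (_, _); apply/ffunP=> j.
have /ffunP/(_ ((s^-1)%g j)) := E2.
by rewrite !ffunE permKV => /addIr/addIr.
Qed.

Lemma porbits_cconj s t x :
  [set s @: (B : {set _}) | B in porbits (cconj s t x).1] = porbits x.1.
Proof.
rewrite /= /porbits -imset_comp.
have conjX p i : (((s * x.1 * s^-1) ^+ p) i = (s^-1) ((x.1 ^+ p) (s i)))%g.
  elim: p => [|p IH]; first by rewrite !expg0 !perm1 permK.
  by rewrite !expgSr permM IH !permM permKV.
have E i : s @: porbit (s * x.1 * s^-1) i = porbit x.1 (s i).
  apply/setP=> j; apply/imsetP/porbitP=> [[_ /porbitP[p ->] ->]|[p ->]].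
    by exists p; rewrite conjX permKV.
  exists ((s^-1)%g ((x.1 ^+ p)%g (s i))); last by rewrite permKV.
  by apply/porbitP; exists p; rewrite conjX.
apply/setP=> B; apply/imsetP/imsetP=> [[i _ ->]|[i _ ->]] /=.
  by exists (s i); rewrite ?E.
by exists ((s^-1)%g i); rewrite //= E permKV.
Qed.

(** The terms in [t] cancel around a cycle, because the conjugated permutation permutes [B]. *)
Lemma sum_color_cconj s t x B : B \in porbits (cconj s t x).1 ->
  \sum_(j in B) (cconj s t x).2 j = \sum_(j in s @: B) x.2 j.
Proof.
move=> /imsetP[i _ BE]; set w := (cconj s t x).1 in BE *.
under eq_bigr => j _ do rewrite /= ffunE.
rewrite !big_split /= -/w sumrN.
have -> : \sum_(j in B) t ((w^-1)%g j) = \sum_(j in B) t j.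
  rewrite (reindex_inj (@perm_inj _ w)) /=.
  apply: eq_big => [j|j _]; last by rewrite permK.
  rewrite BE -!eq_porbit_mem.
  by rewrite -[w j](_ : (w ^+ 1)%g j = _) ?porbit_perm // expg1.
by rewrite addrK big_imset //= => ? ? _ _; apply: perm_inj.
Qed.

Lemma cycle_type_cconj s t x :
  perm_eq (cycle_type (cconj s t x)) (cycle_type x).
Proof.
pose F (B : {set 'I_n}) := (#|B|, \sum_(j in B) x.2 j).
have -> : cycle_type (cconj s t x) =
    map F [seq s @: (B : {set _}) | B <- enum (porbits (cconj s t x).1)].
  rewrite /cycle_type -map_comp; apply/eq_in_map => B.
  rewrite mem_enum /F /= => /sum_color_cconj ->.
  by rewrite card_imset //; apply: perm_inj.
rewrite /cycle_type; apply: (perm_map F); apply: uniq_perm.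
- by rewrite map_inj_uniq ?enum_uniq //; apply/imset_inj/perm_inj.
- exact: enum_uniq.
move=> B; rewrite mem_enum -(porbits_cconj s t x).
apply/mapP/imsetP=> -[D]; rewrite ?mem_enum => DP ->; exists D => //.
by rewrite mem_enum.
Qed.

Lemma sum_conj_class_cconj s t lam (Y : cperm n r -> rat) :
  \sum_(x in conj_class n lam) Y (cconj s t x) = \sum_(x in conj_class n lam) Y x.
Proof.
rewrite [RHS](reindex_inj (@cconj_inj s t)) /=; apply: eq_bigl => x.
by rewrite !inE (permPl (cycle_type_cconj s t x)).
Qed.

(* Only the invariance of the class under conjugation is used, not the fact that
   it is a single orbit. *)
Lemma expect_cconj lam (Y : cperm n r -> rat) (a : rat) :
  conj_class n lam != set0 ->
  (forall x, x \in conj_class n lam ->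
     \sum_s \sum_t Y (cconj s t x) = (n`! * r.-1.+1 ^ n)%:R * a) ->
  expect lam Y = a.
Proof.
move=> cl0 Ya; have N0 : (n`! * r.-1.+1 ^ n)%:R != 0 :> rat.
  by rewrite pnatr_eq0 -lt0n muln_gt0 fact_gt0 expn_gt0.
have C0 : #|conj_class n lam|%:R != 0 :> rat by rewrite pnatr_eq0 cards_eq0.
apply: (mulfI C0); rewrite /expect mulrC divfK //; apply: (mulfI N0).
(* The triple sum is evaluated in both orders: for fixed [s] and [t] it is the class sum of [Y], and
   for fixed [x] it is the hypothesis [Ya]. *)
transitivity (\sum_(s : 'S_n) \sum_(t : {ffun 'I_n -> color r})
    \sum_(x in conj_class n lam) Y (cconj s t x)).
  under [RHS]eq_bigr => s _ do under eq_bigr => t _ do rewrite sum_conj_class_cconj.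
  by rewrite !sumr_const card_Sn card_ffun !card_ord -mulrnA mulnC mulr_natl.
under eq_bigr => s _ do rewrite exchange_big /=.
rewrite exchange_big /=; under eq_bigr => x xl do rewrite Ya //.
by rewrite sumr_const -[LHS]mulr_natl mulrCA.
Qed.

End Conjugation.

(* The condition that (i, 0) be sent to (j, c), moved to one side so that a single
   color shift remains. *)
Definition pc_constraints (n r : nat) (P : pcperm n r) : seq (constraint n r) :=
  [seq ((u.1.1, 1), (u.1.2, 0), - u.2.2)%N
  | u <- enum (setX P.1 P.2) & u.2.1 == u.1.2].

Lemma pc_constraintsP n r (P : pcperm n r) (a : pred (constraint n r)) :
  reflect (forall ij jc, ij \in P.1 -> jc \in P.2 -> jc.1 = ij.2 ->
             a ((ij.1, 1), (ij.2, 0), - jc.2)%N) (all a (pc_constraints P)).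
Proof.
rewrite all_map; apply: (iffP allP) => [aP ij jc ijP jcP jij|aP [ij jc]].
  by apply: (aP (ij, jc)); rewrite mem_filter mem_enum inE /= jij eqxx ijP.
by rewrite mem_filter mem_enum inE /= => /andP[/eqP ? /andP[? ?]]; apply: aP.
Qed.

(** Averaging over conjugates thereby becomes counting solutions [f] for one fixed [x], with
    [f i = (s i, t i)]. *)
Lemma satisfies_cconj n r (x : cperm n r) s t (P : pcperm n r) :
  wf_pcperm P ->
  satisfies (cconj s t x) P =
  all (holds x [ffun i => (s i, t i)]) (pc_constraints P).
Proof.
move=> /eqP wfP.
have E i j c : holds x [ffun i => (s i, t i)] ((i, 1), (j, 0), - c)%N =
    ((cconj s t x).1 i == j) && ((cconj s t x).2 j == c).
  rewrite /holds /cshift /= !ffunE /= -pair_eqE /= !permM.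
  rewrite -(inj_eq (@perm_inj _ s)) permKV; case: eqP => //= sij.
  rewrite !invMg invgK !permM -sij !permK [LHS]subr_eq [RHS]subr_eq.
  by rewrite addrC [t j + c]addrC.
apply/andP/pc_constraintsP => [[/forall_inP P1 /forall_inP P2]|H].
  by move=> ij jc ijP jcP jij; rewrite E P1 //= -jij P2.
split; apply/forall_inP; [move=> ij ijP|move=> jc jcP].
  have : ij.2 \in [set jc.1 | jc in P.2] by rewrite wfP imset_f.
  by case/imsetP=> jc jcP jij; have := H ij jc ijP jcP (esym jij); rewrite E => /andP[].
have : jc.1 \in [set ij.2 | ij in P.1] by rewrite -wfP imset_f.
by case/imsetP=> ij ijP jij; have := H ij jc ijP jcP jij; rewrite E jij => /andP[].
Qed.

Lemma all_holds_pcmap a b r n (x : cperm n r) (u : 'I_a -> 'I_b)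
    (f : {ffun 'I_b -> cpoint n r}) (P : pcperm a r) :
  injective u ->
  all (holds x f) (pc_constraints (pcmap u P)) =
  all (holds x [ffun i => f (u i)]) (pc_constraints P).
Proof.
move=> u_inj; apply/pc_constraintsP/pc_constraintsP=> H.
  move=> ij jc ijP jcP jij.
  have := H (u ij.1, u ij.2) (u jc.1, jc.2).
  rewrite /holds /= !ffunE; apply; rewrite ?jij //.
    exact: (imset_f (fun ij => (u ij.1, u ij.2))).
  by rewrite -jij; apply: (imset_f (fun jc => (u jc.1, jc.2))).
move=> _ _ /imsetP[ij ijP ->] /imsetP[jc jcP ->] /= /u_inj jij.
by have := H ij jc ijP jcP jij; rewrite /holds /= !ffunE.
Qed.

Lemma perm_extend (n s : nat) (u v : 'I_s -> 'I_n) :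
  injective u -> injective v -> exists p : 'S_n, forall i, p (u i) = v i.
Proof.
move=> u_inj v_inj.
(* [l f] lists all of [[n]], beginning with the values of [f]; the permutation matches [l u] with
   [l v] position by position. *)
pose l (f : 'I_s -> 'I_n) := codom f ++ enum [predC codom f].
have l_uniq f : injective f -> uniq (l f).
  move=> f_inj; rewrite cat_uniq enum_uniq (map_inj_uniq f_inj) enum_uniq /= andbT.
  by apply/hasPn=> i; rewrite mem_enum.
have l_mem f i : i \in l f by rewrite mem_cat mem_enum inE /= orbN.
have l_size f : injective f -> size (l f) = n.
  move=> f_inj; rewrite -(card_uniqP (l_uniq _ f_inj)) -[RHS]card_ord.
  by apply/eq_card=> i; rewrite l_mem inE.
pose p i := nth i (l v) (index i (l u)).
have idx i : (index i (l u) < size (l v))%N.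
  by have := index_mem i (l u); rewrite l_mem !l_size.
have p_inj : injective p.
  move=> i j; rewrite /p (set_nth_default j) // => /eqP.
  by rewrite nth_uniq ?l_uniq // => /eqP/index_inj ->.
exists (perm p_inj) => i; rewrite permE /p /l index_cat codom_f.
rewrite index_map // index_enum_ord nth_cat size_codom card_ord ltn_ord.
by rewrite (nth_map i) ?size_enum_ord // nth_ord_enum.
Qed.

(** The sum over [p] is the same for every injection [u], since two injections differ by a
    permutation. Summing it over all injections [v] and exchanging the sums, each [p] merely
    permutes the injections. *)
Lemma sum_perm_inj (n s : nat) (u : 'I_s -> 'I_n) (h : {ffun 'I_s -> 'I_n} -> nat) :
  injective u ->
  (n ^_ s * \sum_(p : 'S_n) h [ffun i => p (u i)] =
   n`! * \sum_(v : {ffun 'I_s -> 'I_n} | injectiveb v) h v)%N.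
Proof.
move=> u_inj.
transitivity (\sum_(v : {ffun 'I_s -> 'I_n} | injectiveb v)
               \sum_(p : 'S_n) h [ffun i => p (v i)])%N.
  have -> : (n ^_ s = #|[set v : {ffun 'I_s -> 'I_n} | injectiveb v]|)%N.
    by rewrite card_inj_ffuns !card_ord.
  rewrite -sum_nat_const big_mkcond [RHS]big_mkcond /=; apply: eq_bigr => v _.
  rewrite inE; case: ifP => // /injectiveP v_inj.
  have [q qE] := perm_extend u_inj v_inj.
  rewrite (reindex_inj (mulgI q)) /=; apply: eq_bigr => p _; congr h.
  by apply/ffunP=> i; rewrite !ffunE permM qE.
rewrite exchange_big /=.
have -> : (n`! = #|{: 'S_n}|)%N by rewrite card_Sn.
rewrite -sum_nat_const.
apply: eq_bigr => p _.
have pK : cancel (fun v : {ffun 'I_s -> 'I_n} => [ffun i => p (v i)])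
                 (fun v => [ffun i => (p^-1)%g (v i)]).
  by move=> v; apply/ffunP=> i; rewrite !ffunE permK.
rewrite [RHS](reindex_inj (can_inj pK)) /=; apply: eq_bigl => v.
apply/injectiveP/injectiveP=> v_inj i j.
  by rewrite !ffunE => /perm_inj/v_inj.
by move=> eq_v; apply: v_inj; rewrite !ffunE eq_v.
Qed.

(** The same double count, with translations of color functions instead of products; [ext] extends a
    function along [u] by 0. *)
Lemma sum_color_inj (n s r : nat) (u : 'I_s -> 'I_n)
    (h : {ffun 'I_s -> color r} -> nat) :
  injective u ->
  (r.-1.+1 ^ s * \sum_(t : {ffun 'I_n -> color r}) h [ffun i => t (u i)] =
   r.-1.+1 ^ n * \sum_(t : {ffun 'I_s -> color r}) h t)%N.
Proof.
move=> u_inj.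
pose ext (t0 : {ffun 'I_s -> color r}) : {ffun 'I_n -> color r} :=
  [ffun j => oapp t0 0 [pick i | u i == j]].
have extE t0 i : ext t0 (u i) = t0 i.
  rewrite ffunE; case: pickP => [k /eqP/u_inj->|/(_ i)] //.
  by rewrite eqxx.
transitivity (\sum_(t0 : {ffun 'I_s -> color r}) \sum_(t : {ffun 'I_n -> color r})
    h [ffun i => (t0 i + t (u i))%R])%N.
  have -> : (r.-1.+1 ^ s = #|{ffun 'I_s -> color r}|)%N by rewrite card_ffun !card_ord.
  rewrite -sum_nat_const; apply: eq_bigr => t0 _.
  rewrite (reindex_inj (addrI (ext t0))) /=; apply: eq_bigr => t _; congr h.
  by apply/ffunP=> i; rewrite !ffunE -extE ffunE.
rewrite exchange_big /=.
have -> : (r.-1.+1 ^ n = #|{ffun 'I_n -> color r}|)%N by rewrite card_ffun !card_ord.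
rewrite -sum_nat_const; apply: eq_bigr => t _.
rewrite [RHS](reindex_inj (addIr [ffun i => t (u i)])) /=; apply: eq_bigr => t0 _.
by congr h; apply/ffunP=> i; rewrite !ffunE.
Qed.

(** In probabilistic terms, a uniform pair of a permutation and a coloring, restricted along [u], is
    a uniform family of colored points over distinct elements. *)
Lemma sum_relabel (n s r : nat) (u : 'I_s -> 'I_n)
    (h : {ffun 'I_s -> cpoint n r} -> nat) :
  injective u ->
  (n ^_ s * r.-1.+1 ^ s *
     \sum_(p : 'S_n) \sum_(t : {ffun 'I_n -> color r})
       h [ffun i => (p (u i), t (u i))] =
   n`! * r.-1.+1 ^ n *
     \sum_(f : {ffun 'I_s -> cpoint n r} | injectiveb (fun i => (f i).1)) h f)%N.
Proof.
move=> u_inj.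
have -> : (\sum_(f : {ffun 'I_s -> cpoint n r} | injectiveb (fun i => (f i).1)) h f =
  \sum_(v : {ffun 'I_s -> 'I_n} | injectiveb v) \sum_(t : {ffun 'I_s -> color r})
    h [ffun i => (v i, t i)])%N.
  rewrite pair_big_dep /=.
  pose F (vt : {ffun 'I_s -> 'I_n} * {ffun 'I_s -> color r}) :
    {ffun 'I_s -> cpoint n r} := [ffun i => (vt.1 i, vt.2 i)].
  rewrite (reindex F) /=; last first.
    exists (fun f => ([ffun i => (f i).1], [ffun i => (f i).2])) => [[v t]|f] _.
      by rewrite /F; congr (_, _); apply/ffunP=> i; rewrite !ffunE.
    by apply/ffunP=> i; rewrite !ffunE -surjective_pairing.
  apply: eq_bigl => -[v t]; rewrite andbT.
  by apply/injectiveP/injectiveP=> v_inj i j ij; apply: v_inj; move: ij; rewrite !ffunE.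
rewrite exchange_big /=.
transitivity (r.-1.+1 ^ s * \sum_(t : {ffun 'I_n -> color r}) (n`! *
    \sum_(v : {ffun 'I_s -> 'I_n} | injectiveb v)
      h [ffun i => (v i, [ffun i => t (u i)] i)]))%N.
  rewrite [(n ^_ s * _)%N]mulnC -mulnA; congr (_ * _)%N.
  rewrite big_distrr /=; apply: eq_bigr => t _.
  rewrite -(sum_perm_inj (fun v => h [ffun i => (v i, [ffun i => t (u i)] i)]) u_inj).
  congr (_ * _)%N; apply: eq_bigr => p _; congr h.
  by apply/ffunP=> i; rewrite !ffunE.
rewrite -big_distrr /= mulnCA -[RHS]mulnA; congr (_ * _)%N.
by rewrite [in RHS]exchange_big (sum_color_inj (fun t =>
     \sum_(v : {ffun 'I_s -> 'I_n} | injectiveb v) h [ffun i => (v i, t i)])%N u_inj).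
Qed.

(** * Tuples of partial colored permutations *)

Section Tuples.
Variables (r k : nat).

Definition tuple_supp n (F : {ffun 'I_k -> pcperm n r}) : {set 'I_n} :=
  \bigcup_i supp (F i).

Definition tuple_constraints n (F : {ffun 'I_k -> pcperm n r}) :
    seq (constraint n r) :=
  flatten [seq pc_constraints (F i) | i <- enum 'I_k].

Lemma all_tuple_constraints n (F : {ffun 'I_k -> pcperm n r}) a :
  all a (tuple_constraints F) = [forall i, all a (pc_constraints (F i))].
Proof.
have all_flat ss : all a (flatten ss) = all (all a) ss.
  by elim: ss => //= e ss IH; rewrite all_cat IH.
rewrite /tuple_constraints all_flat all_map.
apply/allP/forallP=> [H i|H i _]; last exact: H.
by apply: H; rewrite mem_enum.
Qed.

(** Each pair of the tuple gives weight 1 to its source, where its constraint has exponent 1, and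
    none to its target, where the exponent is 0. The total is therefore [m * k]. *)
Definition source_weight n (F : {ffun 'I_k -> pcperm n r}) (v : 'I_n) : nat :=
  (\sum_i \sum_(ij in (F i).1) (ij.1 == v))%N.

Lemma source_weight_gt0 n (F : {ffun 'I_k -> pcperm n r}) i ij :
  ij \in (F i).1 -> (0 < source_weight F ij.1)%N.
Proof.
by move=> ijF; rewrite /source_weight (bigD1 i) //= (bigD1 ij) //= eqxx.
Qed.

Lemma sum_source_weight n (F : {ffun 'I_k -> pcperm n r}) m :
  (forall i, pcsize (F i) = m) -> (\sum_v source_weight F v = m * k)%N.
Proof.
move=> szF; rewrite exchange_big /= mulnC.
rewrite (eq_bigr (fun=> m)) ?sum_nat_const ?card_ord // => i _.
rewrite exchange_big /= -(szF i) /pcsize -sum1_card; apply: eq_bigr => ij _.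
by rewrite (bigD1 ij.1) //= eqxx big1 ?addn0 // => v; rewrite eq_sym => /negbTE ->.
Qed.

Lemma tuple_weighted n (F : {ffun 'I_k -> pcperm n r}) :
  weighted (source_weight F) (tuple_constraints F).
Proof.
suff /allP H : all (fun e => (e.1.1.2 <= source_weight F e.1.1.1)%N
              && (e.1.2.2 <= source_weight F e.1.2.1)%N) (tuple_constraints F).
  by move=> e /H/andP.
rewrite all_tuple_constraints; apply/forallP=> i; apply/pc_constraintsP=> ij jc ijF _ _.
by rewrite /= andbT (source_weight_gt0 ijF).
Qed.

(** A point of the support is a source, of positive weight, or a target, whose constraint ties it to
    a source. *)
Lemma tuple_covered n (F : {ffun 'I_k -> pcperm n r}) :
  (forall i, wf_pcperm (F i)) -> tuple_supp F = setT ->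
  covered (source_weight F) (tuple_constraints F).
Proof.
move=> wfF FT v; have: v \in tuple_supp F by rewrite FT inE.
case/bigcupP=> i _; rewrite inE => /orP[]/imsetP[ij ijF ->].
  by left; apply: source_weight_gt0 ijF.
have : ij.2 \in [set jc.1 | jc in (F i).2] by rewrite (eqP (wfF i)) imset_f.
case/imsetP=> jc jcF jij; right.
exists ((ij.1, 1), (ij.2, 0), - jc.2)%N; split; last first.
  by right; rewrite /= (source_weight_gt0 ijF).
(* Membership in the list is obtained by applying the flattening lemma to the predicate of belonging
   to that list. *)
have := all_tuple_constraints F (mem (tuple_constraints F)).
rewrite (introT allP) // => /esym/forallP/(_ i)/pc_constraintsP; exact.
Qed.

End Tuples.

(** * Patterns *)

Lemma leq_card_supp n r (P : pcperm n r) : (#|supp P| <= 2 * pcsize P)%N.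
Proof.
rewrite (leq_trans (leq_card_setU _ _)) // mul2n -addnn.
by rewrite leq_add // leq_imset_card.
Qed.

Section Patterns.
Variables (n0 r m : nat) (C : {set pcperm n0 r}) (k : nat).
Hypotheses (n0_gt0 : (0 < n0)%N) (C_inv : order_invariant m C).

(** Full joint support makes a pattern the normal form of a tuple after its support is relabeled
    increasingly by [[s]]. *)
Definition patterns s : {set {ffun 'I_k -> pcperm s r}} :=
  [set Q | (Q \in ffun_on (mem (extension C s))) && (tuple_supp Q == setT)].

Definition pattern_count n s (x : cperm n r) (Q : {ffun 'I_k -> pcperm s r}) :=
  #|[set f in solutions x (tuple_constraints Q) | injectiveb (fun i => (f i).1)]|.

Lemma extension_wf s (Q : pcperm s r) : Q \in extension C s -> wf_pcperm Q.
Proof. by case/(mem_extension _ n0_gt0 C_inv). Qed.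

Lemma patterns_eq0 s : (m * k * 2 < s)%N -> patterns s = set0.
Proof.
move=> lt_s; apply/setP=> Q; rewrite !inE; apply/negbTE; apply: contraL lt_s.
case/andP=> /ffun_onP QC /eqP QT; rewrite -leqNgt.
rewrite -[s]card_ord -cardsT -QT mulnAC -mulnA.
apply: leq_trans (_ : \sum_(i < k) #|supp (Q i)| <= _)%N.
  rewrite /tuple_supp.
  apply: (big_ind2 (fun (A : {set 'I_s}) (b : nat) => #|A| <= b)%N) =>
    [|A a B b leA leB|//].
    by rewrite cards0.
  by rewrite (leq_trans (leq_card_setU _ _)) // leq_add.
rewrite mulnA mulnC -[X in (_ <= X * _)%N]card_ord -sum_nat_const.
apply: leq_sum => i _; rewrite (leq_trans (leq_card_supp _)) // mulnC.
by rewrite (pcsize_extension n0_gt0 C_inv (QC i)).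
Qed.

Lemma pattern_count_poly s (Q : {ffun 'I_k -> pcperm s r}) : Q \in patterns s ->
  exists p : {poly rat}, (size p <= (m * k).+1)%N /\
    forall n (x : cperm n r), long_cycles (m * k) x ->
      p.[n%:R] = (pattern_count x Q)%:R.
Proof.
rewrite inE => /andP[/ffun_onP QC /eqP QT].
have wfQ i : wf_pcperm (Q i) by apply: extension_wf (QC i).
have sw : (\sum_v source_weight Q v <= m * k)%N.
  by rewrite (@sum_source_weight _ _ _ _ m) // => i; apply: pcsize_extension (QC i).
exact: (card_inj_solutions_poly (tuple_weighted (F := Q)) (tuple_covered wfQ QT) sw).
Qed.

Lemma pattern_count_eq0 n s (x : cperm n r) (Q : {ffun 'I_k -> pcperm s r}) :
  (n < s)%N -> pattern_count x Q = 0%N.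
Proof.
move=> lt_ns; apply/eqP; rewrite cards_eq0; apply/eqP/setP=> f; rewrite !inE.
apply/negbTE; rewrite negb_and; apply/orP; right; apply: contraL lt_ns.
by move=> /injectiveP/leq_card; rewrite !card_ord -leqNgt.
Qed.

Definition pattern_sum n (x : cperm n r) s : rat :=
  \sum_(Q in patterns s) (pattern_count x Q)%:R / (s`! * r.-1.+1 ^ s)%:R.

Lemma pattern_sum_poly s :
  exists p : {poly rat}, (size p <= (m * k).+1)%N /\
    forall n (x : cperm n r), long_cycles (m * k) x ->
      p.[n%:R] = pattern_sum x s.
Proof.
have [Q|P PE] := @fin_all_exists {ffun 'I_k -> pcperm s r} (fun=> {poly rat})
  (fun Q p => (size p <= (m * k).+1)%N /\ (Q \in patterns s ->
    forall n (x : cperm n r), long_cycles (m * k) x ->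
      p.[n%:R] = (pattern_count x Q)%:R)).
  have [/pattern_count_poly[p [sp pE]]|_] := boolP (Q \in patterns s).
    by exists p.
  by exists 0; rewrite size_poly0.
exists (\sum_(Q in patterns s) (s`! * r.-1.+1 ^ s)%:R^-1 *: P Q); split.
  rewrite (leq_trans (size_sum _ _ _)) //; apply/bigmax_leqP=> Q _.
  by rewrite (leq_trans (size_scale_leq _ _)) //; case: (PE Q).
move=> n x lx; rewrite horner_sum; apply: eq_bigr => Q QC.
by rewrite hornerZ mulrC (proj2 (PE Q) QC n x lx).
Qed.

Lemma ext_stat_expX n (x : cperm n r) s t :
  ext_stat C (cconj s t x) ^+ k =
  \sum_(F : {ffun 'I_k -> pcperm n r} | F \in ffun_on (mem (extension C n)))
     (all (holds x [ffun i => (s i, t i)]) (tuple_constraints F))%:R.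
Proof.
(* The power is a product of [k] equal sums; distributing it gives tuples, and a product of
   indicators is the indicator of the conjunction. *)
rewrite -[k in LHS]card_ord -prodr_const /ext_stat.
rewrite (bigA_distr_big _ (fun (_ : 'I_k) P => (satisfies (cconj s t x) P)%:R)) /=.
apply: eq_bigr => F /ffun_onP FC; rewrite all_tuple_constraints.
under eq_bigr => i _ do rewrite satisfies_cconj ?(extension_wf (FC i)) //.
case: forallP => [H|H]; first by rewrite big1 // => i _; rewrite H.
have [i /negbTE iF] := forallPn (introN forallP H).
by rewrite (bigD1 i) //= iF mul0r.
Qed.

Definition support_enum n (U : {set 'I_n}) (i : 'I_#|U|) : 'I_n := enum_val i.

(** Relabeling by the increasing enumeration of [U] preserves membership in the extension in both
    directions and carries full support to [U]. *)
Lemma tuples_on_support n (U : {set 'I_n}) :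
  [set F : {ffun 'I_k -> pcperm n r} |
     (F \in ffun_on (mem (extension C n))) && (tuple_supp F == U)] =
  [set [ffun i => pcmap (@support_enum n U) (Q i)] |
     Q : {ffun 'I_k -> pcperm #|U| r} in patterns #|U|].
Proof.
set u := @support_enum n U; have u_incr : {homo u : i j / (i < j)%N}.
  by move=> i j; apply: incr_enum_val.
have uT : u @: setT = U.
  apply/setP=> v; apply/imsetP/idP=> [[i _ ->]|vU]; first exact: enum_valP.
  by exists (enum_rank_in vU v); rewrite // /u /support_enum enum_rankK_in.
have suppE (Q : {ffun 'I_k -> pcperm #|U| r}) :
    tuple_supp [ffun i => pcmap u (Q i)] = u @: tuple_supp Q.
  rewrite /tuple_supp; apply/setP=> v; apply/bigcupP/imsetP.
    case=> i _; rewrite ffunE supp_pcmap => /imsetP[w wQ ->]; exists w => //.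
    by apply/bigcupP; exists i.
  case=> w /bigcupP[i _ wQ] ->; exists i => //.
  by rewrite ffunE supp_pcmap imset_f.
apply/setP=> F; rewrite inE; apply/andP/imsetP=> [[/ffun_onP FC /eqP FU]|[Q + ->]].
  have FQ i : exists Q, F i = pcmap u Q.
    apply: pcmap_preim; first exact: extension_wf (FC i).
    apply/subsetP=> v vF; have /imsetP[w _ ->] : v \in u @: setT.
      by rewrite uT -FU; apply/bigcupP; exists i.
    exact: codom_f.
  have [Q QE] := fin_all_exists FQ.
  have FE : F = [ffun i => pcmap u ([ffun i => Q i] i)].
    by apply/ffunP=> i; rewrite !ffunE QE.
  exists [ffun i => Q i] => //; rewrite inE; apply/andP; split.
    apply/ffun_onP=> i; rewrite ffunE.
    by have := FC i; rewrite QE /= (pcmap_extension _ n0_gt0 C_inv).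
  apply/eqP; apply: (imset_inj (@enum_val_inj _ (mem U))).
  by rewrite -[LHS]suppE -FE uT.
rewrite inE => /andP[/ffun_onP QC /eqP QT]; split; last by rewrite suppE QT uT.
by apply/ffun_onP=> i; rewrite ffunE /= (pcmap_extension _ n0_gt0 C_inv) //; apply: QC.
Qed.

End Patterns.

(** * Moments as sums over patterns *)

Section Moments.
Variables (n0 r m : nat) (C : {set pcperm n0 r}) (k : nat).
Hypotheses (n0_gt0 : (0 < n0)%N) (C_inv : order_invariant m C).

Lemma sum_subsets_card n (g : nat -> rat) :
  \sum_(U : {set 'I_n}) g #|U| = \sum_(s < n.+1) 'C(n, s)%:R * g s.
Proof.
have cardU (U : {set 'I_n}) : (#|U| < n.+1)%N.
  by rewrite ltnS -[X in (_ <= X)%N]card_ord max_card.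
rewrite (partition_big (fun U : {set 'I_n} => Ordinal (cardU U)) predT) //=.
apply: eq_bigr => s _.
rewrite (eq_bigr (fun=> g s)) => [|U /eqP <-] //.
rewrite sumr_const mulr_natl; congr (_ *+ _).
have -> : 'C(n, s) = #|[set U : {set 'I_n} | #|U| == s]|.
  by rewrite card_draws card_ord.
by apply: eq_card => U; rewrite [RHS]inE.
Qed.

Lemma sum_trunc (v : nat -> rat) a b :
  (forall s, (a < s)%N -> v s = 0) -> (forall s, (b < s)%N -> v s = 0) ->
  \sum_(s < a.+1) v s = \sum_(s < b.+1) v s.
Proof.
have ext c d : (c <= d)%N -> (forall s, (c < s)%N -> v s = 0) ->
    \sum_(s < c.+1) v s = \sum_(s < d.+1) v s.
  move=> le_cd v0; rewrite (big_ord_widen d.+1 v) ?ltnS // big_mkcond.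
  by apply: eq_bigr => s _; case: ltnP => // /v0 ->.
move=> va vb; rewrite (ext a (maxn a b)) ?leq_maxl //.
by rewrite (ext b (maxn a b)) ?leq_maxr.
Qed.

Lemma sum_relabel_pattern n (x : cperm n r) (U : {set 'I_n})
    (Q : {ffun 'I_k -> pcperm #|U| r}) :
  \sum_(s : 'S_n) \sum_(t : {ffun 'I_n -> color r})
    (all (holds x [ffun i => (s i, t i)])
       (tuple_constraints [ffun i => pcmap (@support_enum n U) (Q i)]))%:R =
  (n`! * r.-1.+1 ^ n)%:R *
    ((pattern_count x Q)%:R / (n ^_ #|U| * r.-1.+1 ^ #|U|)%:R) :> rat.
Proof.
have u_inj : injective (@support_enum n U) by apply: enum_val_inj.
have leU : (#|U| <= n)%N by rewrite -[X in (_ <= X)%N]card_ord max_card.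
have N0 : (n ^_ #|U| * r.-1.+1 ^ #|U|)%:R != 0 :> rat.
  by rewrite pnatr_eq0 -lt0n muln_gt0 ffact_gt0 leU expn_gt0.
apply: (mulIf N0); rewrite -mulrA divfK // -natrM.
have := sum_relabel (fun f => all (holds x f) (tuple_constraints Q) : nat) u_inj.
have -> : (\sum_(f : {ffun 'I_#|U| -> cpoint n r} | injectiveb (fun i => (f i).1))
    all (holds x f) (tuple_constraints Q) = pattern_count x Q)%N.
  rewrite /pattern_count -[RHS]sum1_card big_mkcond [RHS]big_mkcond /=.
  by apply: eq_bigr => f _; rewrite !inE; case: injectiveb; case: all.
move=> <-; rewrite mulrC [RHS]natrM; congr (_ * _).
rewrite natr_sum; apply: eq_bigr => s _; rewrite natr_sum; apply: eq_bigr => t _.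
congr (_%:R); congr (nat_of_bool _); rewrite !all_tuple_constraints.
apply: eq_forallb => i; rewrite ffunE all_holds_pcmap //.
by apply: eq_all => e; congr (holds x _ e); apply/ffunP=> j; rewrite !ffunE.
Qed.

Lemma sum_ext_stat_cconj n (x : cperm n r) :
  \sum_s \sum_t ext_stat C (cconj s t x) ^+ k =
  (n`! * r.-1.+1 ^ n)%:R * \sum_(s < (m * k * 2).+1) pattern_sum C k x s.
Proof.
under eq_bigr => s _ do under eq_bigr => t _ do
  rewrite (ext_stat_expX k n0_gt0 C_inv).
under eq_bigr => s _ do rewrite exchange_big /=.
rewrite exchange_big /= (partition_big (@tuple_supp r k n) predT) //=.
(* Polynomiality needs a range of [s] independent of [n], whereas the subsets of [[n]] give
   [s <= n]. The sums agree: there are no patterns beyond [2mk], and no injective families beyond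
   [n]. *)
rewrite (@sum_trunc (pattern_sum C k x) _ n) => [||s lt_ns]; last first.
- rewrite /pattern_sum big1 // => Q _.
  by rewrite pattern_count_eq0 // mul0r.
- move=> s lt_s; rewrite /pattern_sum (patterns_eq0 _ C_inv) //.
  by rewrite big_set0.
(* The averaged contribution of a support depends only on its size [s]. *)
pose g s := \sum_(Q in patterns C k s)
  (pattern_count x Q)%:R / (n ^_ s * r.-1.+1 ^ s)%:R : rat.
transitivity ((n`! * r.-1.+1 ^ n)%:R * \sum_(U : {set 'I_n}) g #|U|).
  rewrite big_distrr /=; apply: eq_bigr => U _.
  have /setP memU := tuples_on_support k n0_gt0 C_inv U.
  rewrite (eq_bigl (fun F => F \in [set [ffun i => pcmap (@support_enum n U) (Q i)] |
      Q : {ffun 'I_k -> pcperm #|U| r} in patterns C k #|U|])) => [|F]; last first.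
    by rewrite -memU inE.
  rewrite big_imset /=; last first.
    move=> Q Q' _ _ /ffunP eqQ; apply/ffunP=> i.
    by have := eqQ i; rewrite !ffunE => /(pcmap_inj (@enum_val_inj _ _)).
  rewrite /g big_distrr /=; apply: eq_bigr => Q _.
  exact: sum_relabel_pattern.
rewrite sum_subsets_card; congr (_ * _); apply: eq_bigr => s _.
rewrite big_distrr; apply: eq_bigr => Q _ /=.
rewrite mulrCA; congr (_ * _); have le_s : (s <= n)%N by rewrite -ltnS.
(* The falling factorial is the binomial coefficient times [s!], so the number of supports cancels
   and [s! r^s] remains in the denominator. *)
rewrite -bin_ffact -mulnA natrM invfM mulrA divff ?mul1r //.
by rewrite pnatr_eq0 -lt0n bin_gt0.
Qed.

End Moments.

(** The orbit of [i] has more than [q] elements, and its trajectory, run for that length, has no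
    repetition; hence entry [p] differs from entry 0. *)
Lemma conj_class_long_cycles n r q lam (x : cperm n r) :
  (forall (l : nat) (c : color r), (l, c) \in lam -> ~~ (1 <= l <= q)%N) ->
  x \in conj_class n lam -> long_cycles q x.
Proof.
move=> lam_long; rewrite inE => /perm_mem x_lam i p p_q.
have lt_p : (p < #|porbit x.1 i|)%N.
  case/andP: p_q => p_gt0 le_pq.
  have := lam_long #|porbit x.1 i| (\sum_(j in porbit x.1 i) x.2 j).
  rewrite -x_lam lt0n card_porbit_neq0 /= -ltnNge => /(_ _)/(leq_ltn_trans le_pq).
  apply; apply/mapP; exists (porbit x.1 i) => //.
  by rewrite mem_enum imset_f.
have := uniq_traject_porbit x.1 i.
move/(nth_uniq i) => /(_ p 0%N); rewrite size_traject => /(_ lt_p).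
have orb_gt0 : (0 < #|porbit x.1 i|)%N by apply: leq_ltn_trans lt_p.
rewrite orb_gt0 => /(_ isT); rewrite !nth_traject //= => ->.
by case/andP: p_q; case: p {lt_p}.
Qed.

Theorem theorem1p2 (r n0 m : nat) (C : {set pcperm n0 r}) :
  (1 <= r)%N -> (2 <= n0)%N -> order_invariant m C ->
  forall k : nat, (1 <= k)%N ->
  exists p : {poly rat}, (size p <= (m * k).+1)%N /\
    forall (n : nat) (lam : seq (nat * color r)), (1 <= n)%N ->
      conj_class n lam != set0 ->
      (forall (l : nat) (c : color r), (l, c) \in lam ->
         ~~ (1 <= l <= m * k)%N) ->
      p.[n%:R] = expect lam (fun x : cperm n r => ext_stat C x ^+ k).
Proof.
move=> _ n0_gt1 C_inv k _; have n0_gt0 := ltnW n0_gt1.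
have [P PE] := fin_all_exists
  (fun s : 'I_(m * k * 2).+1 => pattern_sum_poly k n0_gt0 C_inv s).
exists (\sum_s P s); split.
  rewrite (leq_trans (size_sum _ _ _)) //; apply/bigmax_leqP=> s _.
  by case: (PE s).
move=> n lam _ lam0 lam_long; apply/esym/expect_cconj => // x x_lam.
have lx := conj_class_long_cycles lam_long x_lam.
rewrite (sum_ext_stat_cconj _ n0_gt0 C_inv) horner_sum; congr (_ * _).
by apply: eq_bigr => s _; rewrite (proj2 (PE s) n x lx).
Qed.
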